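(* Let $(X,\mathcal{A},\mu)$ be a measure space and let $I$ be an ideal of the ring $\mathcal{M}(X,\mathcal{A})$. Then $I\mu(X,\mathcal{A})$ is the (connected) component of $0$ in the ring $\mathcal{M}(X,\mathcal{A})$ equipped with the $m_{\mu_I}$-topology.
   Context: $X$ is a non-empty set, $\mathcal{A}$ a $\sigma$-algebra on $X$, and $\mu:\mathcal{A}\to[0,\infty]$ a measure. $\mathcal{M}(X,\mathcal{A})$ is the commutative ring with unity of all real-valued $\mathcal{A}$-measurable functions on $X$, with pointwise operations. For $g\in\mathcal{M}(X,\mathcal{A})$, $Z(g)=\{x\in X: g(x)=0\}$, and for an ideal $I$, $Z[I]=\{Z(g): g\in I\}$. Null sets $E$ below are always members of $\mathcal{A}$. $I\mu(X,\mathcal{A})$ is the set of all $f\in\mathcal{M}(X,\mathcal{A})$ such that for every $g\in\mathcal{M}(X,\mathcal{A})$ there exist $Z\in Z[I]$ and $E\subseteq Z$ with $\mu(E)=0$ such that $fg$ is bounded on $Z\setminus E$. $U_{\mu_I}^+$ is the set of all $u\in\mathcal{M}(X,\mathcal{A})$ for which there exist $Z\in Z[I]$ and $E\subseteq Z$ with $\mu(E)=0$ such that $u(x)>0$ for all $x\in Z\setminus E$. For $f\in\mathcal{M}(X,\mathcal{A})$ and $u\in U_{\mu_I}^+$, $m_{\mu_I}(f,u)$ is the set of all $g\in\mathcal{M}(X,\mathcal{A})$ for which there exist $Z\in Z[I]$ and $E\subseteq Z$ with $\mu(E)=0$ such that $|g(x)-f(x)|<u(x)$ for all $x\in Z\setminus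 E$. The sets $m_{\mu_I}(f,u)$ ($f\in\mathcal{M}(X,\mathcal{A})$, $u\in U_{\mu_I}^+$) form an open base for a topology on $\mathcal{M}(X,\mathcal{A})$, called the $m_{\mu_I}$-topology; with it $\mathcal{M}(X,\mathcal{A})$ is a topological ring. *)

(* Defs.v *)
From HB Require Import structures.
From mathcomp Require Import all_boot all_order all_algebra.
From mathcomp Require Import all_classical all_reals all_analysis measurable_realfun.
From mathcomp Require Import lra.

Set Implicit Arguments.
Unset Strict Implicit.
Unset Printing Implicit Defensive.
Import Order.TTheory GRing.Theory Num.Theory.
Import numFieldNormedType.Exports.

Local Open Scope classical_set_scope.
Local Open Scope ring_scope.

(* Not required to be proper, unlike [ring_quotient.idealr_closed]. *)
Definition is_ideal (A : comPzRingType) (I : set A) : Prop :=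
  [/\ I 0, (forall f g, I f -> I g -> I (f + g))
    & (forall a f, I f -> I (a * f))].

Section MeasurableFunctions.
Context {d : measure_display} {X : measurableType d} {R : realType}.
Implicit Types (mu : {measure set X -> \bar R}) (I : set {mfun X >-> R}).
Implicit Types (P Q : set X -> Prop) (f g u v : {mfun X >-> R}).

Definition zero_set g : set X := [set x | g x = 0].

Definition zero_sets I : set (set X) := zero_set @` I.

(* [P] holds of Z \ E for some Z in Z[I] and some measurable null subset E of
   Z. *)
Definition on_zset mu I P : Prop :=
  exists Z E, [/\ zero_sets I Z, measurable E, E `<=` Z, mu E = 0%E
                & P (Z `\` E)].

Definition Imu mu I : set {mfun X >-> R} :=
  [set f | forall g, on_zset mu I (fun S => [bounded f x * g x | x in S])].

Definition Upos mu I : set {mfun X >-> R} :=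
  [set u | on_zset mu I (fun S => forall x, S x -> 0 < u x)].

Definition m_nbhd mu I f u : set {mfun X >-> R} :=
  [set g | on_zset mu I (fun S => forall x, S x -> `|g x - f x| < u x)].

Lemma on_zsetT mu I P : is_ideal I -> (forall S, P S) -> on_zset mu I P.
Proof.
by move=> [I0 _ _] PS; exists (zero_set 0), set0; split => //; exists 0.
Qed.

Lemma on_zsetW mu I P Q :
  (forall S, P S -> Q S) -> on_zset mu I P -> on_zset mu I Q.
Proof. by move=> PQ [Z [E [? ? ? ? PS]]]; exists Z, E; split=> //; exact: PQ. Qed.

Lemma on_zsetI mu I P Q : is_ideal I ->
  (forall S S', S' `<=` S -> P S -> P S') ->
  (forall S S', S' `<=` S -> Q S -> Q S') ->
  on_zset mu I P -> on_zset mu I Q -> on_zset mu I (fun S => P S /\ Q S).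
Proof.
move=> [I0 ID IM] monoP monoQ [Z1 [E1 [[f If <-] mE1 _ nE1 PS]]].
move=> [Z2 [E2 [[g Ig <-] mE2 _ nE2 QS]]].
pose h : {mfun X >-> R} := f * f + g * g.
have hE : zero_set h = zero_set f `&` zero_set g.
  have hxE x : h x = f x * f x + g x * g x by [].
  apply/seteqP; split => x.
    move=> /eqP; rewrite hxE -!expr2 paddr_eq0 ?sqr_ge0//.
    by rewrite !expf_eq0 /= => /andP[/eqP ? /eqP ?].
  move=> [fx gx]; suff : h x = 0 by [].
  by rewrite hxE (fx : f x = 0) (gx : g x = 0) mulr0 addr0.
have mZ (k : {mfun X >-> R}) : measurable (zero_set k).
  exact: (measurable_funPTI k (measurable_set1 0)).
have mE : measurable ((E1 `|` E2) `&` zero_set h).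
  by apply: measurableI => //; exact: measurableU.
exists (zero_set h), ((E1 `|` E2) `&` zero_set h); split => //.
- by exists h => //; apply: ID; exact: IM.
- apply/eqP; rewrite eq_le measure_ge0 andbT.
  have nU : mu (E1 `|` E2) = 0%E by rewrite measureU0.
  rewrite -nU; apply: le_measure; rewrite ?inE//.
  exact: measurableU.
- split.
  + apply: monoP PS => x [hx nEx]; split; first by move: hx; rewrite hE => -[].
    by move=> E1x; apply: nEx; split => //; left.
  + apply: monoQ QS => x [hx nEx]; split; first by move: hx; rewrite hE => -[].
    by move=> E2x; apply: nEx; split => //; right.
Qed.

Lemma on_zsetI_forall mu I (p q : X -> Prop) : is_ideal I ->
  on_zset mu I (fun S => forall x, S x -> p x) ->
  on_zset mu I (fun S => forall x, S x -> q x) ->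
  on_zset mu I (fun S => forall x, S x -> p x /\ q x).
Proof.
move=> hI hp hq.
apply: on_zsetW (on_zsetI hI _ _ hp hq); last 2 first.
- by move=> S S' SS' h x /SS'/h.
- by move=> S S' SS' h x /SS'/h.
by move=> S [h h'] x Sx; split; [exact: h|exact: h'].
Qed.

Lemma m_nbhd_join mu I f1 u1 f2 u2 g : is_ideal I ->
  m_nbhd mu I f1 u1 g -> m_nbhd mu I f2 u2 g ->
  exists2 v, Upos mu I v &
    m_nbhd mu I g v `<=` m_nbhd mu I f1 u1 `&` m_nbhd mu I f2 u2.
Proof.
move=> hI g1 g2.
have mv : measurable_fun [set: X]
    (fun x => Num.min (u1 x - `|g x - f1 x|) (u2 x - `|g x - f2 x|)).
  apply: measurable_minr; apply: measurable_funB => //;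
    apply: measurableT_comp => //; exact: measurable_funB.
pose v : {mfun X >-> R} := mfun_Sub (mem_set mv).
have vE x : v x = Num.min (u1 x - `|g x - f1 x|) (u2 x - `|g x - f2 x|).
  by [].
exists v.
  apply: on_zsetW (on_zsetI_forall hI g1 g2) => S h x /h[h1 h2].
  by rewrite vE lt_min !subr_gt0 h1 h2.
have tri (a b c w w' : R) : `|a - b| < w' -> w' <= w - `|b - c| -> `|a - c| < w.
  move=> h1 h2; rewrite -(subrK b a) -addrA (le_lt_trans (ler_normD _ _))//.
  lra.
move=> h gh; split; apply: on_zsetW gh => S gh x /gh hx; apply: tri hx _.
  by rewrite vE ge_min lexx.
by rewrite vE ge_min lexx orbT.
Qed.

(* The ring M(X, A) carrying the topology with base the sets m(f, u); the
   ideal hypothesis is a parameter because it is what makes them a base. *)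
Definition m_space mu I (hI : is_ideal I) : Type := {mfun X >-> R}.

Section Topology.
Variables (mu : {measure set X -> \bar R}) (I : set {mfun X >-> R}).
Variable hI : is_ideal I.

HB.instance Definition _ := GRing.ComNzRing.copy (m_space mu hI) {mfun X >-> R}.
HB.instance Definition _ := isPointed.Build (m_space mu hI) 0.

Let D : set (m_space mu hI * m_space mu hI) := [set fu | Upos mu I fu.2].

Let b (fu : m_space mu hI * m_space mu hI) : set (m_space mu hI) :=
  m_nbhd mu I fu.1 fu.2.

Let b_cover : \bigcup_(fu in D) b fu = setT.
Proof.
apply/seteqP; split => // f _; exists (f, 1).
  by apply: on_zsetT => // S x _; exact: ltr01.
by apply: on_zsetT => // S x _ /=; rewrite subrr normr0; exact: ltr01.
Qed.

Let b_join (i j : m_space mu hI * m_space mu hI) (g : m_space mu hI) :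
  D i -> D j -> b i g -> b j g ->
  exists k, [/\ D k, b k g & b k `<=` b i `&` b j].
Proof.
move=> _ _ ig jg; have [v v0 sub] := m_nbhd_join hI ig jg.
exists (g, v); split => //.
by apply: on_zsetW v0 => S v0 x /v0; rewrite subrr normr0.
Qed.

HB.instance Definition _ :=
  isBaseTopological.Build (m_space mu hI) b_cover b_join.

End Topology.

End MeasurableFunctions.

(* Main.v *)
Require Import Defs.
From mathcomp Require Import all_boot all_order all_algebra.
From mathcomp Require Import all_classical all_reals all_analysis measurable_realfun.
Import Order.TTheory GRing.Theory Num.Theory.
Import numFieldNormedType.Exports.
Local Open Scope classical_set_scope.
Local Open Scope ring_scope.

(** Write C_g for the set of all h such that h g is bounded on some Z \ E, with
    Z in Z[I] and E null; then [Imu] is the intersection of all the C_g.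

    Each C_g is clopen, because belonging to it is insensitive to errors
    smaller than u = 1 / (1 + |g|): such an error changes h g by less than 1
    ([bounded_mul_stable]). As u does not depend on h, and being u-close is a
    symmetric relation, the same neighbourhoods show that C_g and its complement
    are open ([clopen_bounded_mul]). A connected set through 0, which lies in
    C_g, therefore stays in C_g; so the component of 0 lies in [Imu].

    Conversely, if f is in [Imu] then the line t |-> t f is continuous
    ([continuous_line]): for a radius v, testing membership of f in
    [Imu] on g = 1 / v gives |f| <= M v on some Z \ E, hence |s f - t f| < v
    there as soon as |s - t| < 1 / M. The line is then a connected set that
    contains 0 and f. *)

Lemma bounded_gt0P (T : Type) (R : realType) (f : T -> R) (S : set T) :
  [bounded f x | x in S] <-> exists2 M, 0 < M & forall x, S x -> `|f x| <= M.
Proof.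
split=> [/pinfty_ex_gt0[M M0 SM]|[M M0 SM]]; first by exists M.
exists M; split=> [|N MN x Sx]; first exact: gtr0_real.
exact: le_trans (SM x Sx) (ltW MN).
Qed.

Lemma bounded_subset (T : Type) (R : realType) (f : T -> R) (S S' : set T) :
  S' `<=` S -> [bounded f x | x in S] -> [bounded f x | x in S'].
Proof.
move=> SS' /bounded_gt0P[M M0 fM].
by apply/bounded_gt0P; exists M => // x /SS'/fM.
Qed.

Lemma connected_sub_clopen (T : topologicalType) (A C : set T) :
  connected A -> clopen C -> A `&` C !=set0 -> A `<=` C.
Proof.
by move=> cA [oC clC] /cA <-; [move=> x []|exists C|exists C].
Qed.

Section MTopology.
Context {d : measure_display} {X : measurableType d} {R : realType}.
Variables (mu : {measure set X -> \bar R}) (I : set {mfun X >-> R}).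
Hypothesis hI : is_ideal I.
Implicit Types f g h u v : {mfun X >-> R}.

(** The real power -1 is a measurable function on the whole line that agrees
    with the inverse on positive numbers. *)
Lemma mfun_inv_pos u :
  exists w : {mfun X >-> R}, forall x, 0 < u x -> w x = (u x)^-1.
Proof.
have mw : measurable_fun [set: X] (fun x => u x `^ (-1)).
  exact: (measurableT_comp (measurable_powR _)).
exists (mfun_Sub (mem_set mw)) => x ux /=.
by rewrite powR_inv1// ltW.
Qed.

Lemma m_nbhdxx f u : Upos mu I u -> m_nbhd mu I f u f.
Proof. by apply: on_zsetW => S u0 x /u0; rewrite subrr normr0. Qed.

Lemma m_nbhdC f u g : m_nbhd mu I f u g -> m_nbhd mu I g u f.
Proof. by apply: on_zsetW => S fg x /fg; rewrite distrC. Qed.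

(** A basic open set that contains f contains one that is centred at f; this
    lets the topology be handled as if by balls. *)
Lemma open_m_spaceP (A : set (m_space mu hI)) :
  open A <->
  forall f, A f -> exists2 v, Upos mu I v & m_nbhd mu I f v `<=` A.
Proof.
split=> [[D' D'pos <-] f [[f0 u] D'fu /= f0u]|Anbhd].
  have [v v0 sub] := m_nbhd_join hI f0u f0u.
  by exists v => // g /sub[gf _]; exists (f0, u).
exists [set fu : m_space mu hI * m_space mu hI |
  Upos mu I fu.2 /\ m_nbhd mu I fu.1 fu.2 `<=` A]; first by move=> ? [].
apply/seteqP; split=> [g [fu [_ sub] /sub]//|f Af].
have [v v0 sub] := Anbhd f Af.
by exists (f, v) => //; exact: m_nbhdxx.
Qed.

Definition bounded_mul g : set (m_space mu hI) :=
  [set h | on_zset mu I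
             (fun S => [bounded (h : {mfun X >-> R}) x * g x | x in S])].

(** The radius is the same at every h, which makes the complement of
    [bounded_mul g] open as well. *)
Lemma bounded_mul_stable g : exists2 u, Upos mu I u &
  forall h, bounded_mul g h -> m_nbhd mu I h u `<=` bounded_mul g.
Proof.
have mk : measurable_fun [set: X] (fun x => 1 + `|g x|).
  by apply: measurable_funD => //; exact: measurableT_comp.
have [u uE] := mfun_inv_pos (mfun_Sub (mem_set mk)).
have g1 x : 0 < 1 + `|g x| by rewrite ltr_pwDl.
have {}uE x : u x = (1 + `|g x|)^-1 by exact: (uE x (g1 x)).
exists u.
  by apply: on_zsetT => // S x _; rewrite uE invr_gt0.
move=> h hg k hk.
apply: on_zsetW (on_zsetI hI _ _ hg hk); last 2 first.
- by move=> S S'; exact: bounded_subset.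
- by move=> S S' SS' H x /SS'/H.
move=> S [/bounded_gt0P[M M0 hM] kh].
apply/bounded_gt0P; exists (M + 1) => [|x Sx]; first exact: addr_gt0.
(* k g = h g + (k - h) g *)
rewrite -[k x](subrK (h x)) addrC mulrDl (le_trans (ler_normD _ _))//.
apply: lerD; first exact: hM.
rewrite normrM; apply: le_trans (_ : u x * (1 + `|g x|) <= 1); last first.
  by rewrite uE mulVf// gt_eqF.
by apply: ler_pM => //; [exact/ltW/kh|rewrite lerDr].
Qed.

Lemma clopen_bounded_mul g : clopen (bounded_mul g).
Proof.
have [u u0 stab] := bounded_mul_stable g.
split; first by apply/open_m_spaceP => f /stab ?; exists u.
rewrite -[bounded_mul g]setCK; apply: open_closedC; apply/open_m_spaceP => f nf.
by exists u => // k /m_nbhdC fk /stab/(_ _ fk).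
Qed.

(** For a general f the line t |-> t f need not be continuous, since f may
    outgrow every constant multiple of a radius v; on [Imu] the quotient f / v
    is bounded on some Z \ E, which is what continuity needs. *)
Lemma continuous_line f : Imu mu I f ->
  continuous ((fun t : R => scale_mfun t f) : R -> m_space mu hI).
Proof.
move=> If; apply/continuousP => A /open_m_spaceP oA.
rewrite openE => t /oA[v v0 sub].
have [w wE] := mfun_inv_pos v.
have : on_zset mu I (fun S => exists2 M, 0 < M &
    forall x, S x -> `|f x| <= M * v x /\ 0 < v x).
  apply: on_zsetW (on_zsetI hI _ _ (If w) v0); last 2 first.
  - by move=> S S'; exact: bounded_subset.
  - by move=> S S' SS' H x /SS'/H.
  move=> S [/bounded_gt0P[M M0 fM] vS].
  exists M => // x Sx; have vx := vS x Sx; split=> //.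
  have := fM x Sx; rewrite wE// normrM normfV (gtr0_norm vx).
  by rewrite ler_pdivrMr.
move=> [Z [E [IZ mE EZ E0 [M M0 fM]]]].
apply/nbhs_ballP; exists M^-1; first by rewrite /= invr_gt0.
move=> s; rewrite /ball/= => ts; apply: sub.
exists Z, E; split=> // x Sx; have [fx vx] := fM x Sx.
rewrite /= -mulrBr normrM distrC.
have -> : v x = M * v x * M^-1 by rewrite mulrAC divff ?mul1r// gt_eqF.
apply: le_lt_trans (ler_wpM2r _ fx) _ => //.
by rewrite ltr_pM2l// mulr_gt0.
Qed.

End MTopology.

Theorem theorem2p5 (d : measure_display) (X : measurableType d) (R : realType)
    (mu : {measure set X -> \bar R}) (I : set {mfun X >-> R})
    (hI : is_ideal I) :
  connected_component [set: m_space mu hI] 0 = Imu mu I.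
Proof.
apply/seteqP; split=> [f [C [C0 _ cC] Cf] g|f If].
  apply: (connected_sub_clopen _ _ _ cC (clopen_bounded_mul mu I hI g)) Cf.
  exists 0; split=> //; apply: on_zsetT => // S.
  by apply/bounded_gt0P; exists 1 => // x _; rewrite mul0r normr0.
exists (range (fun t => scale_mfun t f : m_space mu hI)).
  split=> //; first by exists 0 => //; apply/mfuneqP => x /=; rewrite mulr0.
  apply: connected_continuous_connected; last first.
    exact/continuous_subspaceT/continuous_line.
  exact/connected_intervalP.
by exists 1 => //; apply/mfuneqP => x /=; rewrite mulr1.
Qed.
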